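(* Let $X$ be a real Hilbert space (finite- or infinite-dimensional). Let $\mathcal{C}$ be a nonempty finite collection of nonempty polyhedral cones in $X$. Let $\lambda\in\left]0,1\right]$ and $x^{(0)}\in X$. Let $(x^{(n)})_{n\in\mathbb{N}}$ be any sequence in $X$ generated as follows: given the current term $x^{(n)}$, pick $R_n\in\mathcal{R}_{\mathcal{C},[\lambda,2-\lambda]}$ and update via $$x^{(n+1)}:=R_n x^{(n)}.$$ Then $$\sum_{n=0}^\infty \|x^{(n+1)}-x^{(n)}\|^\gamma<+\infty\quad\text{for all }\gamma>0.$$
   Context: $\mathbb{N}=\{0,1,2,\ldots\}$. A subset $C$ of $X$ is a cone if $\mathbb{R}_{++}C=C$, where $\mathbb{R}_{++}=\left]0,+\infty\right[$. A subset of $X$ is polyhedral if it is the intersection of finitely many closed halfspaces; a polyhedral cone is a subset of $X$ that is both polyhedral and a cone. For a nonempty closed convex subset $C$ of $X$, $P_C$ denotes the metric projector onto $C$, mapping each $x\in X$ to its unique nearest point in $C$; $\operatorname{Id}$ is the identity on $X$. For a nonempty finite collection $\mathcal{C}$ of (nonempty) closed convex subsets of $X$ and an interval $\Lambda\subseteq[0,2]$, $$\mathcal{R}_{\mathcal{C},\Lambda}:=\{(1-\mu)\operatorname{Id}+\mu P_C \mid C\in\mathcal{C},\ \mu\in\Lambda\}.$$ The choices of $R_n$ are arbitrary at each step. *)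

(* Defs.v *)
From mathcomp Require Import all_boot all_order all_algebra.
From mathcomp Require Import all_classical all_reals all_analysis.

Set Implicit Arguments.
Unset Strict Implicit.
Unset Printing Implicit Defensive.

Import Order.TTheory GRing.Theory Num.Theory.
Import numFieldNormedType.Exports.

Local Open Scope classical_set_scope.
Local Open Scope ring_scope.

(* A real Hilbert space is rendered as a complete normed module over a
   [realType] together with a symmetric positive definite bilinear form
   [dot : {dot X for idfun}] that induces the norm. *)
Definition induces_norm (R : realType) (X : normedModType R)
    (dot : {dot X for idfun}) : Prop :=
  forall x : X, `|x| = Num.sqrt (dot x x).

Definition is_cone (R : realType) (X : lmodType R) (C : set X) : Prop :=
  [set t *: x | t in [set t : R | 0 < t] & x in C] = C.

Definition closed_halfspace (R : realType) (X : normedModType R)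
    (dot : {dot X for idfun}) (H : set X) : Prop :=
  exists2 a : X, a != 0 & exists b : R, H = [set x | dot a x <= b].

(* The intersection of the empty family of halfspaces is the whole space. *)
Definition polyhedral (R : realType) (X : normedModType R)
    (dot : {dot X for idfun}) (C : set X) : Prop :=
  exists HH : set (set X),
    [/\ finite_set HH, HH `<=` closed_halfspace dot & C = \bigcap_(H in HH) H].

Definition polyhedral_cone (R : realType) (X : normedModType R)
    (dot : {dot X for idfun}) (C : set X) : Prop :=
  polyhedral dot C /\ is_cone C.

Definition nearest_points (R : realType) (X : normedModType R)
    (C : set X) (x : X) : set X :=
  [set p | C p /\ forall y, C y -> `|x - p| <= `|x - y|].

(* In a Hilbert space, [nearest_points C x] is a singleton when [C] is
   nonempty, closed and convex; [0] is a junk value for the other cases. *)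
Definition metric_projector (R : realType) (X : normedModType R)
    (C : set X) (x : X) : X :=
  xget 0 (nearest_points C x).

Definition relaxed_projectors (R : realType) (X : normedModType R)
    (CC : set (set X)) (L : set R) : set (X -> X) :=
  [set (fun x : X => (1 - mu) *: x + mu *: metric_projector C x)
    | C in CC & mu in L].

(* Main.v *)
(* The projection of [x] onto a polyhedral cone is the projection of [x] onto
   the subspace of the vectors orthogonal to the constraints active at the
   nearest point, so that the iteration only uses relaxed projections onto
   finitely many closed subspaces [L_i] of finite codimension.  For a set [I]
   of indices, let [L_I] be the intersection of the [L_i] with [i] in [I].

   A finite composition of such relaxed projections that uses each index of [I]
   at least once, and no other, contracts the distance to [L_I] by a factor
   smaller than one that depends on [I] only, not on the number of factors.

   By induction on the cardinality of [I], the sum of the [gamma]-th powers of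
   the step lengths of a sequence that uses indices of [I] is at most a constant
   times the [gamma]-th power of the distance of its starting point to [L_I]:
   cut the sequence into shortest blocks that use all of [I].  Without its last
   step, a block uses fewer indices, and from block to block the distance
   decays geometrically. *)
Require Import Defs.
From mathcomp Require Import all_boot all_order all_algebra.
From mathcomp Require Import all_classical all_reals all_analysis.
From mathcomp Require Import ring lra.

Set Implicit Arguments.
Unset Strict Implicit.
Unset Printing Implicit Defensive.

Import Order.TTheory GRing.Theory Num.Theory.
Import numFieldNormedType.Exports.

Local Open Scope classical_set_scope.
Local Open Scope ring_scope.

(** * Orthogonal projections onto spans of finite families *)

Section InnerProduct.
Variables (R : realType) (X : normedModType R) (dot : {dot X for idfun}).

Local Notation "''[' u , v ]" := (dot u v) : ring_scope.

Lemma dotDl u v w : '[u + v, w] = '[u, w] + '[v, w].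
Proof. by rewrite linearDl. Qed.

Lemma dotNl u w : '[- u, w] = - '[u, w].
Proof. by rewrite linearNl. Qed.

Lemma dotZl a u w : '[a *: u, w] = a * '[u, w].
Proof. by rewrite linearZl_LR. Qed.

Lemma dotC u v : '[u, v] = '[v, u].
Proof. by rewrite hermC expr0 mul1r. Qed.

Lemma dotDr u v w : '[w, u + v] = '[w, u] + '[w, v].
Proof. by rewrite linearDr. Qed.

Lemma dotNr u w : '[w, - u] = - '[w, u].
Proof. by rewrite linearNr. Qed.

Lemma dotZr a u w : '[w, a *: u] = a * '[w, u].
Proof. by rewrite dotC dotZl dotC. Qed.

Definition dotE := (dotDl, dotDr, dotNl, dotNr, dotZl, dotZr).

Lemma dot_gt0 u : u != 0 -> 0 < '[u, u].
Proof. exact: neq0_dnorm_gt0. Qed.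

Lemma dot_ge0 u : 0 <= '[u, u].
Proof.
have [->|/dot_gt0/ltW//] := eqVneq u 0.
by rewrite linear0l.
Qed.

Hypothesis hdot : induces_norm dot.

Lemma normXE u : `|u| ^+ 2 = '[u, u].
Proof. by rewrite hdot sqr_sqrtr // dot_ge0. Qed.

Lemma cauchy_schwarz u v : `|'[u, v]| <= `|u| * `|v|.
Proof.
rewrite -ler_sqr ?nnegrE ?mulr_ge0// real_normK ?num_real// exprMn !normXE.
have [->|/dot_gt0 v0] := eqVneq v 0; first by rewrite !linear0r expr0n.
have := dot_ge0 ('[v, v] *: u - '[u, v] *: v).
rewrite !dotE (dotC v u) => h.
rewrite -subr_ge0 -(pmulr_rge0 _ v0); move: h; congr (_ <= _); ring.
Qed.

Lemma pythagoras u v : '[u, v] = 0 -> `|u + v| ^+ 2 = `|u| ^+ 2 + `|v| ^+ 2.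
Proof. by move=> uv; rewrite !normXE !dotE (dotC v) uv; ring. Qed.

(* Gram-Schmidt; when [a] already lies in the span of [A], the added term is
   [0] thanks to the convention [0 / 0 = 0]. *)
Fixpoint span_proj (A : seq X) (x : X) : X :=
  if A is a :: A' then
    let u := a - span_proj A' a in
    span_proj A' x + ('[u, x] / '[u, u]) *: u
  else 0.

Definition perp (A : seq X) (y : X) := forall a, a \in A -> '[a, y] = 0.

Lemma perp_cons a A y : perp (a :: A) y <-> '[a, y] = 0 /\ perp A y.
Proof.
split=> [h|[h1 h2] b]; last by rewrite inE => /predU1P[->|/h2].
by split=> [|b bA]; apply: h; rewrite inE ?eqxx ?bA ?orbT.
Qed.

Lemma perp_span_proj A x y : perp A y -> '[span_proj A x, y] = 0.
Proof.
elim: A x => [|a A IH] x /=; first by rewrite linear0l.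
case/perp_cons => ay Ay; rewrite !dotE !IH// ay; ring.
Qed.

Lemma span_proj_perp A x : perp A (x - span_proj A x).
Proof.
elim: A x => [|a A IH] x /=; first by [].
have Au := IH a.
have ae : a = span_proj A a + (a - span_proj A a) by rewrite addrC subrK.
move: (a - _) => u in Au ae *.
apply/perp_cons; split; last first.
  by move=> b bA; rewrite opprD addrA !dotE Au// mulr0 subr0 -dotNr -dotDr IH.
(* The part of [a] in the span of [A] contributes [0]; only the pairing with [u] remains, and the
   coefficient of [u] is chosen to cancel it. *)
rewrite [X in '[X, _]]ae dotDl opprD addrA.
rewrite dotDr perp_span_proj// dotNr dotZr perp_span_proj// mulr0 oppr0 !add0r.
rewrite !dotE (dotC u (span_proj A x)) perp_span_proj// subr0.
have [->|/dot_gt0 u0] := eqVneq u 0; first by rewrite !linear0l subrr.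
by rewrite divfK ?subrr// gt_eqF.
Qed.

Lemma span_proj_self A x : '[span_proj A x, span_proj A x] = '[span_proj A x, x].
Proof.
apply/eqP; rewrite -subr_eq0 -dotNr -dotDr -opprB dotNr.
by rewrite perp_span_proj ?oppr0//; exact: span_proj_perp.
Qed.

(** The second hypothesis encodes that [q] lies in the span of [A]. The difference of two candidates
    is in [perp A] and orthogonal to [perp A], hence to itself. *)
Lemma span_proj_unique A x q : perp A (x - q) ->
  (forall y, perp A y -> '[q, y] = 0) -> q = span_proj A x.
Proof.
move=> h1 h2.
have pd : perp A (q - span_proj A x).
  move=> a aA; have := h1 _ aA; have := span_proj_perp x aA.
  by rewrite !dotE => ? ?; lra.
apply/eqP; rewrite -subr_eq0; apply: contraT => /dot_gt0.
by rewrite dotDl dotNl h2// perp_span_proj// subr0 ltxx.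
Qed.

Lemma span_projD A x y : span_proj A (x + y) = span_proj A x + span_proj A y.
Proof.
apply/esym/span_proj_unique => [a aA|z Az].
  have := span_proj_perp x aA; have := span_proj_perp y aA.
  by rewrite !dotE => ? ?; lra.
by rewrite dotDl !perp_span_proj// addr0.
Qed.

Lemma span_projN A x : span_proj A (- x) = - span_proj A x.
Proof.
apply/esym/span_proj_unique => [a aA|z Az].
  by have := span_proj_perp x aA; rewrite !dotE => ?; lra.
by rewrite dotNl perp_span_proj// oppr0.
Qed.

Lemma span_proj_fix A q : (forall y, perp A y -> '[q, y] = 0) ->
  span_proj A q = q.
Proof.
by move=> h; apply/esym/span_proj_unique => // a _; rewrite subrr linear0r.
Qed.

Lemma norm_span_proj_split A x :
  `|x| ^+ 2 = `|span_proj A x| ^+ 2 + `|x - span_proj A x| ^+ 2.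
Proof.
rewrite -pythagoras; first by rewrite addrC subrK.
exact/perp_span_proj/span_proj_perp.
Qed.

Lemma norm_span_proj_mono A B x : {subset A <= B} ->
  `|span_proj A x| <= `|span_proj B x|.
Proof.
move=> AB; have [->|] := eqVneq `|span_proj A x| 0; first exact: normr_ge0.
rewrite -normr_gt0 normr_id => A0; rewrite -(ler_pM2l A0) -expr2 normXE.
apply: le_trans (cauchy_schwarz _ _); apply: le_trans (ler_norm _).
rewrite span_proj_self -subr_le0 -dotNr -dotDr perp_span_proj//.
by move=> a /AB; apply: span_proj_perp.
Qed.

Lemma norm_span_proj_le A x : `|span_proj A x| <= `|x|.
Proof.
rewrite -ler_sqr ?nnegrE// [leRHS](norm_span_proj_split A) lerDl.
exact: sqr_ge0.
Qed.

Lemma dot_span_proj A a x : a \in A -> '[a, x] = '[a, span_proj A x].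
Proof.
move=> aA; have := span_proj_perp x aA; rewrite !dotE => /eqP.
by rewrite subr_eq0 => /eqP.
Qed.

(* Hoffman's error bound for the subspace orthogonal to [A]. *)
Lemma error_bound A : exists K, forall x,
  `|span_proj A x| <= K * \sum_(a <- A) `|'[a, x]|.
Proof.
elim: A => [|a A [K hK]] /=; first by exists 0 => x; rewrite normr0 mul0r.
set u := a - _.
have Au : perp A u by exact: span_proj_perp.
have [u0|u0] := eqVneq u 0.
  exists (`|K|) => x; rewrite u0 scaler0 addr0 big_cons.
  apply: le_trans (hK x) _.
  apply: (@le_trans _ _ (`|K| * \sum_(b <- A) `|'[b, x]|)).
    by rewrite ler_wpM2r ?ler_norm// sumr_ge0.
  by rewrite ler_wpM2l// lerDr.
have u0' : 0 < `|u| by rewrite normr_gt0.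
(* The second summand bounds the new Gram-Schmidt term, of norm [|'[u, x]| / |u|], through ['[u, x]
   = '[a, x] - '[a, span_proj A x]]. *)
exists (`|K| + `|u|^-1 * (1 + `|a| * `|K|)) => x; rewrite big_cons.
set s := \sum_(b <- A) _.
have s0 : 0 <= s by rewrite sumr_ge0.
have h : `|span_proj A x| <= `|K| * s.
  by apply: le_trans (hK x) _; rewrite ler_wpM2r ?ler_norm.
apply: le_trans (ler_normD _ _) _.
rewrite mulrDl lerD//; first by apply: le_trans h _; rewrite ler_wpM2l// lerDr.
rewrite normrZ normrM normfV -normXE (ger0_norm (sqr_ge0 _)).
rewrite expr2 invfM !mulrA mulfVK ?gt_eqF// mulrC -mulrA ler_wpM2l ?invr_ge0//.
have -> : '[u, x] = '[a, x] - '[a, span_proj A x].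
  rewrite /u dotDl dotNl; congr (_ - _).
  have e := perp_span_proj a (span_proj_perp (A := A) x).
  have e' := perp_span_proj x (span_proj_perp (A := A) a).
  move: e e'; rewrite !dotE (dotC _ a) (dotC _ (span_proj A a)) => e e'; lra.
apply: le_trans (ler_normB _ _) _; rewrite mulrDl mul1r -addrA lerD//.
apply: le_trans (cauchy_schwarz _ _) _; rewrite -mulrA.
rewrite (@le_trans _ _ (`|a| * (`|K| * s)))// ?ler_wpM2l//.
by rewrite -[leLHS]add0r lerD// ler_wpM2l// ler_wpM2l// lerDr.
Qed.

End InnerProduct.

(** * Finite compositions of relaxed projections *)

Section Words.
Variables (R : realType) (X : normedModType R) (dot : {dot X for idfun}).
Hypothesis hdot : induces_norm dot.
Variables (J : finType) (A : J -> seq X) (lambda : R).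
Hypothesis lambda_gt0 : 0 < lambda.

Implicit Types (I : {set J}) (i : J) (s : J * R) (w : seq (J * R)) (x : X).

Local Notation "''[' u , v ]" := (dot u v) : ring_scope.
Local Notation Q := (span_proj dot).

(* The relaxed projection, with parameter [s.2], onto the subspace of the
   vectors orthogonal to [A s.1]. *)
Definition step (s : J * R) (x : X) : X := x - s.2 *: Q (A s.1) x.

Definition run (w : seq (J * R)) (x : X) : X := foldl (fun y s => step s y) x w.

Definition letters (w : seq (J * R)) : {set J} := [set j in map fst w].

Definition admissible (w : seq (J * R)) :=
  all (fun s => lambda <= s.2 <= 2 - lambda) w.

Definition generators (I : {set J}) : seq X :=
  flatten [seq A j | j <- enum I].

(* The distance of [x] to the intersection of the subspaces indexed by [I]. *)
Definition dist_inter (I : {set J}) (x : X) : R := `|Q (generators I) x|.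

Lemma run_cat w1 w2 x : run (w1 ++ w2) x = run w2 (run w1 x).
Proof. exact: foldl_cat. Qed.

Lemma letters_nil : letters [::] = finset.set0.
Proof. by apply/setP => j; rewrite !inE. Qed.

Lemma letters_cons s w : letters (s :: w) = s.1 |: letters w.
Proof. by apply/setP => j; rewrite !inE. Qed.

Lemma letters_cat w1 w2 : letters (w1 ++ w2) = letters w1 :|: letters w2.
Proof. by apply/setP => j; rewrite !inE map_cat mem_cat. Qed.

Lemma letters_rcons w s : letters (rcons w s) = s.1 |: letters w.
Proof. by apply/setP => j; rewrite !inE map_rcons mem_rcons inE. Qed.

Lemma generatorsP I a :
  reflect (exists2 j, j \in I & a \in A j) (a \in generators I).
Proof.
apply: (iffP flattenP) => [[s /mapP[j]]|[j jI aj]].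
  by rewrite mem_enum => jI -> aj; exists j.
by exists (A j) => //; apply/mapP; exists j; rewrite ?mem_enum.
Qed.

Lemma generators_sub I I' : I \subset I' -> {subset generators I <= generators I'}.
Proof.
by move=> /fintype.subsetP II' a /generatorsP[j /II' jI aj]; apply/generatorsP; exists j.
Qed.

Lemma dist_inter_ge0 I x : 0 <= dist_inter I x.
Proof. exact: normr_ge0. Qed.

Lemma dist_inter_mono I I' x : I \subset I' -> dist_inter I x <= dist_inter I' x.
Proof. by move=> /generators_sub; exact: norm_span_proj_mono. Qed.

Lemma dist_letter_le I i x : i \in I -> `|Q (A i) x| <= dist_inter I x.
Proof.
by move=> iI; apply: norm_span_proj_mono => // a ai; apply/generatorsP; exists i.
Qed.

(** The step multiplies the component [q] of [x] by [1 - mu] and keeps the orthogonal one, so the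
    squared norm drops by [mu * (2 - mu) * |q| ^+ 2]. *)
Lemma step_decrease s x : lambda <= s.2 <= 2 - lambda ->
  (lambda * `|Q (A s.1) x|) ^+ 2 <= `|x| ^+ 2 - `|step s x| ^+ 2.
Proof.
case: s => j mu /= /andP[mu1 mu2]; rewrite /step /=; set q := Q _ x.
have xq : '[q, x - q] = 0 by exact/perp_span_proj/span_proj_perp.
have -> : x - mu *: q = (1 - mu) *: q + (x - q).
  by rewrite scalerBl scale1r [RHS]addrC addrA subrK.
rewrite (norm_span_proj_split hdot (A j) x) -/q.
rewrite (pythagoras hdot (u := (1 - mu) *: q)) ?dotZl ?xq ?mulr0//.
rewrite normrZ !exprMn real_normK ?num_real//.
rewrite -subr_ge0.
have -> : `|q| ^+ 2 + `|x - q| ^+ 2 - ((1 - mu) ^+ 2 * `|q| ^+ 2 + `|x - q| ^+ 2)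
  - lambda ^+ 2 * `|q| ^+ 2 = (mu * (2 - mu) - lambda ^+ 2) * `|q| ^+ 2 by ring.
rewrite mulr_ge0 ?sqr_ge0//.
have l0 := lambda_gt0.
(* The two products add up to [mu * (2 - mu) - lambda ^+ 2]. *)
have h1 : 0 <= (mu - lambda) * (2 - mu) by apply: mulr_ge0; lra.
have h2 : 0 <= lambda * (2 - mu - lambda) by apply: mulr_ge0; lra.
by rewrite expr2; lra.
Qed.

Lemma norm_run_le w x : admissible w -> `|run w x| <= `|x|.
Proof.
elim: w x => //= s w IH x /andP[hs hw].
apply: le_trans (IH (step s x) hw) _.
rewrite -ler_sqr ?nnegrE// -subr_ge0.
by apply: le_trans (step_decrease x hs); exact: sqr_ge0.
Qed.

Lemma run_displacement I w x y : letters w \subset I ->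
  perp dot (generators I) y -> '[x - run w x, y] = 0.
Proof.
move=> + Iy; elim: w x => [|s w IH] x /=; first by rewrite subrr linear0l.
rewrite letters_cons finset.subUset finset.sub1set => /andP[sI wI].
have -> : x - run w (step s x) = (x - step s x) + (step s x - run w (step s x)).
  by rewrite addrA subrK.
rewrite dotDl IH// addr0 /step opprB addrC subrK dotZl.
rewrite perp_span_proj ?mulr0// => a aA; apply: Iy.
by apply/generatorsP; exists s.1.
Qed.

Lemma run_displacementE I w x : letters w \subset I ->
  Q (generators I) (x - run w x) = x - run w x.
Proof. by move=> wI; apply: span_proj_fix => y; exact: run_displacement. Qed.

(** A run moves only within the span of the generators, so the component orthogonal to them cancels
    on the left. *)
Lemma run_energy I w x : letters w \subset I ->
  `|x| ^+ 2 - `|run w x| ^+ 2 = dist_inter I x ^+ 2 - dist_inter I (run w x) ^+ 2.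
Proof.
move=> wI; rewrite (norm_span_proj_split hdot (generators I) x).
rewrite (norm_span_proj_split hdot (generators I) (run w x)).
have -> : x - Q (generators I) x = run w x - Q (generators I) (run w x).
  have := run_displacementE x wI; rewrite span_projD span_projN => e.
  rewrite -{1}[x](subrK (run w x)) -e addrAC (addrAC (Q _ x)) subrr add0r.
  exact: addrC.
by rewrite /dist_inter; ring.
Qed.

Lemma dist_inter_run_le I w x : admissible w -> letters w \subset I ->
  dist_inter I (run w x) <= dist_inter I x.
Proof.
move=> hw wI.
rewrite -ler_sqr ?nnegrE ?dist_inter_ge0// -subr_ge0 -run_energy// subr_ge0.
by rewrite ler_sqr ?nnegrE// norm_run_le.
Qed.


Lemma finite_bound (T : finType) (f : T -> R) :
  exists2 K, 0 <= K & forall t, f t <= K.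
Proof.
exists (\sum_t `|f t|) => [|t]; first exact: sumr_ge0.
by rewrite (bigD1 t)//= -[leLHS]addr0 lerD ?ler_norm ?sumr_ge0.
Qed.

Lemma letters_eq0 w : letters w = finset.set0 -> w = [::].
Proof. by case: w => // s w /setP/(_ s.1); rewrite !inE eqxx. Qed.

(* The shortest prefix of [w] that uses all letters of [w] ends with the first
   occurrence of its last letter. *)
Lemma split_letters w : w != [::] -> exists w1 s w2,
  [/\ w = w1 ++ s :: w2, s.1 \in letters w & letters w1 = letters w :\ s.1].
Proof.
elim/last_ind: w => // w s IH _; rewrite letters_rcons.
have [sw|sw] := boolP (s.1 \in letters w); last first.
  by exists w, s, [::]; rewrite cats1 setU11 setU1K.
have w0 : w != [::] by apply: contraTneq sw => ->; rewrite !inE.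
have -> : s.1 |: letters w = letters w by apply/finset.setUidPr; rewrite finset.sub1set.
have [w1 [t [w2 [e tw w1E]]]] := IH w0.
by exists w1, t, (rcons w2 s); rewrite {1}e rcons_cat.
Qed.

(** Each generator of [I] comes from [A i] or from [I :\ i], so its pairing with [x] is controlled
    by one of the two distances; the error bound concludes. Finiteness of [{set J}] makes the
    constant uniform. *)
Lemma regularity : exists2 K, 0 <= K & forall I i x, i \in I ->
  dist_inter I x <= K * (dist_inter (I :\ i) x + `|Q (A i) x|).
Proof.
have /choice[f hf] I := error_bound hdot (generators I).
have [K K0 hK] := finite_bound f.
pose g I := \sum_(a <- generators I) `|a|.
have [G G0 hG] := finite_bound g.
exists (K * G) => [|I i x iI]; first exact: mulr_ge0.
set d := _ + _.
have d0 : 0 <= d by rewrite addr_ge0 ?dist_inter_ge0.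
apply: le_trans (hf I x) _; rewrite -mulrA.
apply: (@le_trans _ _ (K * \sum_(a <- generators I) `|'[a, x]|)).
  by rewrite ler_wpM2r// sumr_ge0.
rewrite ler_wpM2l//; apply: (@le_trans _ _ (g I * d)); last by rewrite ler_wpM2r.
rewrite mulr_suml big_seq [leRHS]big_seq.
apply: ler_sum => a /generatorsP[j jI aj].
have [ji|ji] := eqVneq j i.
  subst j; rewrite (dot_span_proj dot x aj).
  apply: le_trans (cauchy_schwarz hdot _ _) _.
  by rewrite ler_wpM2l// lerDr dist_inter_ge0.
have aI : a \in generators (I :\ i).
  by apply/generatorsP; exists j; rewrite // !inE ji.
rewrite (dot_span_proj dot x aI).
apply: le_trans (cauchy_schwarz hdot _ _) _.
by rewrite ler_wpM2l// lerDl.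
Qed.

(* A word using exactly the letters of [I] can only preserve the norm of [x]
   if [x] is already near all the subspaces: this is clear for those occurring
   before the last new letter [i], by induction; hence [x] hardly moves before
   that letter, so that it is also near the subspace of [i]. *)
Lemma contraction n : exists2 K, 0 <= K & forall I, #|I| = n ->
  forall w x, admissible w -> letters w = I ->
  dist_inter I x <= K * Num.sqrt (`|x| ^+ 2 - `|run w x| ^+ 2).
Proof.
elim: n => [|n [K K0 hK]].
  exists 0 => // I /cards0_eq -> w x _ _; rewrite mul0r.
  by rewrite /dist_inter /generators enum_set0 normr0.
have [H H0 hH] := regularity.
have lam0 := lambda_gt0.
(* One [K] comes from [h1], two from the displacement in [h3], and [lambda^-1] from the step in
   [h2]. *)
exists (H * (3 * K + lambda^-1)) => [|I In w x adw wI].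
  by rewrite mulr_ge0// addr_ge0 ?mulr_ge0// invr_ge0 ltW.
have w0 : w != [::].
  by apply: contra_eq_neq In => w0; rewrite -wI w0 letters_nil cards0.
have [w1 [s [w2 [we]]]] := split_letters w0; rewrite wI => sI w1I.
move: adw; rewrite we /admissible all_cat /= => /and3P[adw1 ads adw2].
set y := run w1 x; set D := `|x| ^+ 2 - _.
have xy : `|y| <= `|x| by exact: norm_run_le adw1.
have yz : `|run w x| <= `|step s y| by rewrite we run_cat; exact: norm_run_le adw2.
have zy : `|step s y| <= `|y|.
  by apply: (norm_run_le (w := [:: s])); rewrite /admissible /= ads.
have sq (u v : X) : `|u| <= `|v| -> `|u| ^+ 2 <= `|v| ^+ 2.
  by move=> uv; rewrite ler_sqr ?nnegrE.
have h1 : dist_inter (I :\ s.1) x <= K * Num.sqrt D.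
  apply: le_trans (hK _ _ w1 x adw1 w1I) _.
    by move: In; rewrite (cardsD1 s.1) sI => -[].
  rewrite ler_wpM2l// ler_wsqrtr// /D -we lerD2l lerN2.
  by apply: sq; exact: le_trans zy.
have h2 : `|Q (A s.1) y| <= lambda^-1 * Num.sqrt D.
  have q0 : 0 <= lambda * `|Q (A s.1) y| by rewrite mulr_ge0// ltW.
  rewrite ler_pdivlMl// -(ger0_norm q0) -sqrtr_sqr ler_wsqrtr//.
  apply: le_trans (step_decrease y ads) _.
  by rewrite /D -we; apply: lerB; exact: sq.
have w1s : letters w1 \subset I :\ s.1 by rewrite w1I.
have h3 : `|Q (A s.1) (x - y)| <= 2 * (K * Num.sqrt D).
  apply: le_trans (norm_span_proj_le hdot _ _) _.
  rewrite -(run_displacementE x w1s) span_projD span_projN.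
  apply: le_trans (ler_normB _ _) _.
  have := dist_inter_run_le x adw1 w1s; rewrite -/y /dist_inter in h1 *; lra.
have h4 : `|Q (A s.1) x| <= `|Q (A s.1) (x - y)| + `|Q (A s.1) y|.
  by rewrite -{1}(subrK y x) (span_projD dot _ (x - y)) ler_normD.
apply: le_trans (hH _ _ x sI) _; rewrite -mulrA ler_wpM2l// mulrDl; lra.
Qed.

(** * Sums of powers of step lengths *)

Variable gamma : R.
Hypothesis gamma_gt0 : 0 < gamma.

Fixpoint path_length w x : R :=
  if w is s :: w' then `|step s x - x| `^ gamma + path_length w' (step s x)
  else 0.

Lemma path_length_cat w1 w2 x :
  path_length (w1 ++ w2) x = path_length w1 x + path_length w2 (run w1 x).
Proof. by elim: w1 x => [|s w1 IH] x /=; rewrite ?add0r// IH addrA. Qed.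

Lemma ler_gpowR (a b : R) : 0 <= a -> a <= b -> a `^ gamma <= b `^ gamma.
Proof.
move=> a0 ab; apply: ge0_ler_powR; rewrite ?nnegrE ?(ltW gamma_gt0)//.
exact: le_trans ab.
Qed.

Lemma step_length_le I s x : s.1 \in I -> lambda <= s.2 <= 2 - lambda ->
  `|step s x - x| `^ gamma <= 2 `^ gamma * dist_inter I x `^ gamma.
Proof.
move=> sI /andP[s1 s2]; rewrite -powRM ?dist_inter_ge0//; apply: ler_gpowR => //.
rewrite /step addrAC subrr add0r normrN normrZ.
have lam0 := lambda_gt0.
apply: ler_pM => //; last exact: dist_letter_le.
by rewrite ger0_norm; lra.
Qed.

(** By [run_energy], [contraction] reads [d ^+ 2 <= K ^+ 2 * (d ^+ 2 - d' ^+ 2)] for the distances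
    [d] before and [d'] after the run. Hence [d' ^+ 2 <= (1 - K ^- 2) * d ^+ 2]. *)
Lemma contraction_rate n : exists2 th, 0 <= th < 1 & forall I, #|I| = n ->
  forall w x, admissible w -> letters w = I ->
  dist_inter I (run w x) `^ gamma <= th * dist_inter I x `^ gamma.
Proof.
(* Adding [1] ensures that [1 - K ^- 2] lies between [0] and [1]. *)
have [K0 K00 hK0] := contraction n; pose K := K0 + 1.
have K1 : 1 <= K by rewrite /K lerDr.
have Kp : 0 < K by exact: lt_le_trans K1.
have r0 : 0 <= 1 - K ^- 2 by rewrite subr_ge0 invf_le1 ?exprn_gt0// exprn_ege1.
pose r := Num.sqrt (1 - K ^- 2).
exists (r `^ gamma) => [|I In w x adw wI].
  have r1 : r < 1.
    by rewrite -[ltRHS]sqrtr1 ltr_sqrt// ltrBlDr ltrDl invr_gt0 exprn_gt0.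
  have := gt0_ltr_powR gamma_gt0 _ _ r1; rewrite powR_ge0 powR1.
  by apply; rewrite nnegrE ?sqrtr_ge0.
rewrite -powRM ?sqrtr_ge0 ?dist_inter_ge0//.
apply: ler_gpowR; first exact: dist_inter_ge0.
have wI' : letters w \subset I by rewrite wI.
have := hK0 I In w x adw wI; rewrite (run_energy x wI') => h.
set d := dist_inter I x in h *; set d' := dist_inter I _ in h *.
have d0 : 0 <= d by exact: dist_inter_ge0.
have d'0 : 0 <= d' by exact: dist_inter_ge0.
have dd : d' <= d by exact: dist_inter_run_le.
have dd2 : 0 <= d ^+ 2 - d' ^+ 2 by rewrite subr_ge0 ler_sqr ?nnegrE.
have {}h : d ^+ 2 <= K ^+ 2 * (d ^+ 2 - d' ^+ 2).
  rewrite -[X in _ * X]sqr_sqrtr// -exprMn ler_sqr ?nnegrE ?mulr_ge0 ?(ltW Kp)//.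
  by apply: le_trans h _; rewrite ler_wpM2r// lerDl.
rewrite -[d']ger0_norm// -sqrtr_sqr -[d]ger0_norm// -sqrtr_sqr -sqrtrM// ler_wsqrtr//.
have {}h : K ^- 2 * d ^+ 2 <= d ^+ 2 - d' ^+ 2.
  by rewrite ler_pdivrMl ?exprn_gt0.
lra.
Qed.

Lemma path_length_bound n : exists2 T, 0 <= T & forall I, #|I| = n ->
  forall w x, admissible w -> letters w \subset I ->
  path_length w x <= T * dist_inter I x `^ gamma.
Proof.
elim: n => [|n [T T0 hT]].
  exists 0 => // I /cards0_eq -> w x _.
  by rewrite finset.subset0 => /eqP/letters_eq0 ->; rewrite mul0r.
have [th /andP[th0 th1] hth] := contraction_rate n.+1.
(* [B] is the cost of one block: [T] for the prefix that misses a letter, the power of [2] for its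
   last step. Summing the geometric series over the blocks gives [B / (1 - th)]. *)
pose B := T + 2 `^ gamma.
have B0 : 0 <= B by rewrite addr_ge0// powR_ge0.
have TB : T <= B by rewrite lerDl powR_ge0.
have th1' : 0 < 1 - th by rewrite subr_gt0.
have BK : B <= B / (1 - th).
  by rewrite ler_pdivlMr// ler_piMr// lerBlDr lerDl.
exists (B / (1 - th)) => [|I In w]; first by rewrite divr_ge0// ltW.
have small j v x : j \in I -> letters v \subset I :\ j -> admissible v ->
    path_length v x <= T * dist_inter I x `^ gamma.
  move=> jI vI adv; apply: le_trans (hT (I :\ j) _ v x adv vI) _.
    by move: In; rewrite (cardsD1 j) jI => -[].
  rewrite ler_wpM2l//; apply: ler_gpowR; first exact: dist_inter_ge0.
  by apply: dist_inter_mono; exact: finset.subsetDl.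
have [m] := ubnP (size w); elim: m w => // m IH w wm x adw wI.
(* A word that misses a letter is the incomplete final block. *)
have [we|wne] := eqVneq (letters w) I; last first.
  have : letters w \proper I by rewrite finset.properEneq wne.
  case/properP => _ [j jI jw].
  apply: le_trans (small j w x jI _ adw) _; first by rewrite finset.subsetD1 wI.
  by rewrite ler_wpM2r ?powR_ge0// (le_trans TB).
have w0 : w != [::].
  by apply: contra_eq_neq In => w0; rewrite -we w0 letters_nil cards0.
have [w1 [s [w2 [e]]]] := split_letters w0; rewrite we => sI w1I.
move: adw wI wm; rewrite e /admissible all_cat /= => /and3P[adw1 ads adw2].
rewrite letters_cat letters_cons !finset.subUset => /and3P[_ _ w2I].
rewrite size_cat /= addnS ltnS => wm.
rewrite -cat_rcons path_length_cat -cats1 path_length_cat /= addr0.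
set y := run w1 x; set z := run _ x.
have h1 : path_length w1 x <= T * dist_inter I x `^ gamma.
  by apply: small sI _ adw1; rewrite w1I.
have w1s : letters w1 \subset I by rewrite w1I; exact: finset.subsetDl.
have h2 : `|step s y - y| `^ gamma <= 2 `^ gamma * dist_inter I x `^ gamma.
  apply: le_trans (step_length_le y sI ads) _.
  rewrite ler_wpM2l ?powR_ge0//; apply: ler_gpowR; first exact: dist_inter_ge0.
  exact: dist_inter_run_le.
have h3 : path_length w2 z <= B / (1 - th) * dist_inter I z `^ gamma.
  by apply: IH => //; rewrite (leq_ltn_trans _ wm)// leq_addl.
have h4 : dist_inter I z `^ gamma <= th * dist_inter I x `^ gamma.
  apply: hth => //; first by rewrite /admissible all_cat /= adw1 ads.
  by rewrite cats1 letters_rcons w1I finset.setD1K.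
have h5 := ler_wpM2l (le_trans B0 BK) h4.
apply: (@le_trans _ _ (B * dist_inter I x `^ gamma +
    B / (1 - th) * (th * dist_inter I x `^ gamma))).
  by rewrite lerD ?(le_trans h3)// /B mulrDl lerD.
rewrite mulrA -mulrDl ler_wpM2r ?powR_ge0//.
rewrite le_eqVlt; apply/orP; left; apply/eqP; field.
by rewrite gt_eqF.
Qed.

End Words.

(** * Projections onto polyhedral cones *)

Section PolyhedralCones.
Variables (R : realType) (X : normedModType R) (dot : {dot X for idfun}).
Hypothesis hdot : induces_norm dot.

Local Notation "''[' u , v ]" := (dot u v) : ring_scope.
Local Notation Q := (span_proj dot).

Implicit Types (s : seq X) (C : set X) (m : bitseq).

Definition dual_cone s : set X := [set y | forall a, a \in s -> '[a, y] <= 0].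

(** Shrinking a point of the cone towards [0] shows that every offset is nonnegative; stretching it
    shows that every pairing is nonpositive. So all offsets can be replaced by [0]. *)
Lemma polyhedral_cone_dual C : C !=set0 -> polyhedral_cone dot C ->
  exists s, C = dual_cone s.
Proof.
move=> [y0 Cy0] [[HH [finHH HHhalf CE]] coneC].
have Cscale t y : 0 < t -> C y -> C (t *: y).
  by move=> t0 Cy; rewrite -coneC; exists t => //; exists y.
have /choice[ab hab] H : exists ab : X * R,
    HH H -> H = [set x | '[ab.1, x] <= ab.2].
  have [/HHhalf[a _ [b ->]]|nH] := pselect (HH H); first by exists (a, b).
  by exists (0, 0).
have /finite_seqP[hs HHE] := finHH.
have halfE H : H \in hs -> HH H by rewrite HHE.
have Cle H y : H \in hs -> C y -> '[(ab H).1, y] <= (ab H).2.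
  move=> /halfE HH_H; rewrite CE => /(_ H HH_H); rewrite {1}(hab H HH_H).
  by [].
have b_ge0 H : H \in hs -> 0 <= (ab H).2.
  move=> Hhs; rewrite leNgt; apply/negP => b0.
  have v0 : 0 < `|'[(ab H).1, y0]| + 1 by rewrite ltr_wpDl.
  have t0 : 0 < - (ab H).2 / (`|'[(ab H).1, y0]| + 1) by rewrite divr_gt0// oppr_gt0.
  have := Cle H _ Hhs (Cscale _ _ t0 Cy0).
  rewrite dotZr leNgt => /negP; apply.
  rewrite mulrAC ltr_pdivlMr// -subr_gt0.
  set v := '[_, _].
  have -> : - (ab H).2 * v - (ab H).2 * (`|v| + 1) =
    - (ab H).2 * (v + `|v| + 1) by ring.
  by rewrite mulr_gt0 ?oppr_gt0// ltr_wpDl// addrC -lerBlDr sub0r -normrN ler_norm.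
have dot_le0 H y : H \in hs -> C y -> '[(ab H).1, y] <= 0.
  move=> Hhs Cy; rewrite leNgt; apply/negP => v0.
  have t0 : 0 < ((ab H).2 + 1) / '[(ab H).1, y].
    by rewrite divr_gt0// ltr_wpDl// b_ge0.
  have := Cle H _ Hhs (Cscale _ _ t0 Cy).
  by rewrite dotZr divfK ?gt_eqF// gerDl ler10.
exists [seq (ab H).1 | H <- hs]; apply/seteqP; split=> [y Cy a /mapP[H Hhs ->]|y hy].
  exact: dot_le0.
rewrite CE => H HH_H; rewrite (hab H HH_H) /=.
have Hhs : H \in hs by move: HH_H; rewrite HHE.
by apply: le_trans (b_ge0 H Hhs); apply: hy; apply/mapP; exists H.
Qed.

Lemma dual_cone_segment s t y z : 0 <= t <= 1 -> dual_cone s y -> dual_cone s z ->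
  dual_cone s (y + t *: (z - y)).
Proof.
move=> /andP[t0 t1] Cy Cz a sa; rewrite !dotE.
have := Cy a sa; have := Cz a sa; set u := '[a, z]; set v := '[a, y] => u0 v0.
have -> : v + t * (u - v) = - ((1 - t) * (- v) + t * (- u)) by ring.
by rewrite oppr_le0 addr_ge0// mulr_ge0//; lra.
Qed.

(** With [p] the projection of [x], the vectors [x - p] and [p - y] are orthogonal, and moving from
    [y] towards [p] only shrinks the second one. *)
Lemma dist_segment_le A x y t : perp dot A (x - Q A x - y) -> 0 <= t <= 1 ->
  `|x - (y + t *: (x - Q A x - y))| <= `|x - y|.
Proof.
move=> Ay /andP[t0 t1]; set p := x - Q A x.
have xp : x - p = Q A x by rewrite /p opprB addrC subrK.
have orth : '[x - p, p - y] = 0 by rewrite xp perp_span_proj.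
have -> : x - (y + t *: (p - y)) = (x - p) + (1 - t) *: (p - y).
  by rewrite scalerBl scale1r [RHS]addrA [in RHS]addrA subrK opprD [LHS]addrA.
have -> : x - y = (x - p) + (p - y) by rewrite addrA subrK.
rewrite -ler_sqr ?nnegrE// (pythagoras hdot (u := x - p)) ?dotZr ?orth ?mulr0//.
rewrite (pythagoras hdot orth) lerD2l normrZ exprMn ler_piMl ?sqr_ge0//.
by rewrite expr_le1// ger0_norm; lra.
Qed.

(* Moving from [y] towards its projection on the subspace of the constraints
   active at [y] decreases the distance to [x]; if the projection is infeasible,
   then a further constraint becomes active on the way, so that one can iterate. *)
Lemma feasible_span_proj s x y : dual_cone s y -> exists m,
  [/\ size m = size s, dual_cone s (x - Q (mask m s) x) &
      `|x - (x - Q (mask m s) x)| <= `|x - y|].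
Proof.
have [n] := ubnP (count (fun a => '[a, y] != 0) s).
elim: n y => // n IH y yn Cy.
pose A := mask [seq '[a, y] == 0 | a <- s] s.
have AE : A = [seq a <- s | '[a, y] == 0] by rewrite /A -filter_mask.
pose p := x - Q A x.
have py : perp dot A (p - y).
  move=> a aA; rewrite dotDr dotNr (span_proj_perp dot x aA).
  by move: aA; rewrite AE mem_filter => /andP[/eqP-> _]; rewrite subrr.
have act a : a \in s -> '[a, y] = 0 -> '[a, p] = 0.
  by move=> sa ay; apply: span_proj_perp; rewrite AE mem_filter ay eqxx.
have [/allP Cp|/allPn[a1 sa1]] := boolP (all (fun a => '[a, p] <= 0) s).
  exists [seq '[a, y] == 0 | a <- s]; split; [by rewrite size_map|exact: Cp|].
  have := @dist_segment_le A x y 1 py; rewrite scale1r lexx ler01 (addrC y) subrK.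
  exact.
rewrite -ltNge => a1p.
(* The parameter at which constraint [i] becomes active on the segment from [y] to [p]. Its minimum
   over the constraints violated at [p] is the longest feasible move. *)
pose ratio (i : 'I_(size s)) := '[s`_i, y] / ('[s`_i, y] - '[s`_i, p]).
have i1 : (index a1 s < size s)%N by rewrite index_mem.
have Pi1 : 0 < '[s`_(Ordinal i1), p] by rewrite /= nth_index.
case: (@arg_minP _ _ _ (Ordinal i1) (fun i => 0 < '[s`_i, p]) ratio Pi1) => i0 Pi0 imin.
have neg (i : 'I_(size s)) : 0 < '[s`_i, p] -> '[s`_i, y] < 0.
  move=> Pi; have si : s`_i \in s by rewrite mem_nth.
  rewrite lt_neqAle Cy// andbT; apply: contraTneq Pi => /(act _ si) ->.
  by rewrite ltxx.
have ratioP (i : 'I_(size s)) : 0 < '[s`_i, p] -> 0 <= ratio i <= 1.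
  move=> Pi; have := neg i Pi => Ni.
  have d0 : '[s`_i, y] - '[s`_i, p] < 0 by lra.
  by rewrite /ratio ler_ndivlMr// ler_ndivrMr//; apply/andP; split; lra.
have /andP[t0 t1] := ratioP i0 Pi0.
pose t := ratio i0; pose z := y + t *: (p - y).
have zE a : '[a, z] = '[a, y] + t * ('[a, p] - '[a, y]) by rewrite /z !dotE.
have Cz : dual_cone s z.
  move=> a sa; have ia : (index a s < size s)%N by rewrite index_mem.
  have [ap|ap] := lerP '[a, p] 0.
    rewrite zE; have ay := Cy a sa.
    have -> : '[a, y] + t * ('[a, p] - '[a, y]) =
       - ((1 - t) * (- '[a, y]) + t * (- '[a, p])) by ring.
    by rewrite oppr_le0 addr_ge0// mulr_ge0 ?oppr_ge0// subr_ge0.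
  have Pi : 0 < '[s`_(Ordinal ia), p] by rewrite /= nth_index.
  have := imin _ Pi; have := neg _ Pi; rewrite /ratio /= nth_index// -/(ratio i0) -/t.
  move=> ay; rewrite ler_ndivlMr; last by lra.
  by rewrite zE; lra.
have zi0 : '[s`_i0, z] = 0.
  rewrite zE /t /ratio; field.
  by have := neg _ Pi0; move: Pi0 => /= ? ?; apply/eqP; lra.
have [|m [sm Cm hm]] := IH z _ Cz; last first.
- exists m; split => //; apply: le_trans hm _.
  by apply: dist_segment_le => //; apply/andP.
move: yn; rewrite ltnS; apply: leq_trans.
(* Active constraints stay active and [i0] joins them, so the count of inactive ones drops. *)
have sub a : a \in s -> '[a, z] != 0 -> '[a, y] != 0.
  move=> sa; apply: contra => /eqP ay; rewrite zE ay act// subrr mulr0 addr0.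
  by [].
set f := fun a => _ != 0; set g := fun a => _ != 0.
have -> : count f s = count f [seq a <- s | g a].
  rewrite count_filter; apply: eq_in_count => a sa /=.
  by rewrite /f /g; case: eqP => //= /eqP/(sub a sa) ->.
rewrite -(size_filter g) ltn_neqAle count_size andbT -all_count.
apply/allPn; exists s`_i0; last by rewrite /f zi0 eqxx.
by rewrite mem_filter mem_nth// andbT /g lt_eqF// neg.
Qed.

(** There are finitely many masks. The closest of the feasible projections beats every feasible [y],
    because [feasible_span_proj] finds one at least as close as [y]. *)
Lemma nearest_span_proj s x : exists2 m,
  size m = size s & nearest_points (dual_cone s) x (x - Q (mask m s) x).
Proof.
pose P (m : (size s).-tuple bool) := `[< dual_cone s (x - Q (mask m s) x) >].
pose f (m : (size s).-tuple bool) := `|x - (x - Q (mask m s) x)|.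
have C0 : dual_cone s 0 by move=> a _; rewrite linear0r.
have [m0 [sm0 Cm0 _]] := feasible_span_proj x C0.
have sm0' : size m0 == size s by rewrite sm0.
have Pm0 : P (Tuple sm0') by apply/asboolP.
case: (arg_minP f Pm0) => m /asboolP Pm mmin.
exists m; rewrite ?size_tuple//; split=> // y /(feasible_span_proj x)[m1 [sm1 Cm1 hm1]].
apply: le_trans hm1.
have sm1' : size m1 == size s by rewrite sm1.
by apply: (mmin (Tuple sm1')); apply/asboolP.
Qed.

Lemma nearest_dual_cone_unique s x p q :
  nearest_points (dual_cone s) x p -> nearest_points (dual_cone s) x q -> p = q.
Proof.
move=> [Cp hp] [Cq hq].
have half : 0 <= 2^-1 :> R by rewrite invr_ge0.
(* If [p] and [q] differed, their midpoint would be strictly closer to [x] than [p]. *)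
have /hp h1 : dual_cone s (p + 2^-1 *: (q - p)).
  by apply: dual_cone_segment => //; apply/andP; split => //; lra.
have h2 := hq p Cp.
apply/eqP; rewrite -subr_eq0; apply: contraT => /(dot_gt0 dot).
have sq (u v : X) : `|u| <= `|v| -> `|u| ^+ 2 <= `|v| ^+ 2.
  by move=> uv; rewrite ler_sqr ?nnegrE.
move: (sq _ _ h1) (sq _ _ h2); rewrite !(normXE hdot) !dotE.
rewrite (dotC dot q p) (dotC dot q x) (dotC dot p x); lra.
Qed.

Lemma metric_projector_dual_cone s x : exists2 m,
  size m = size s & metric_projector (dual_cone s) x = x - Q (mask m s) x.
Proof.
have [m sm hm] := nearest_span_proj s x; exists m => //.
apply: xget_unique => // q hq; exact: nearest_dual_cone_unique hq hm.
Qed.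

(** The family [A] may vary with [x] even for a fixed cone, but always stays in the finite list [F]
    of all masked constraint lists. *)
Lemma metric_projector_finite (CC : set (set X)) : finite_set CC ->
  (forall C, CC C -> C !=set0 /\ polyhedral_cone dot C) ->
  exists F : seq (seq X), forall C x, CC C ->
    exists2 A, A \in F & metric_projector C x = x - Q A x.
Proof.
move=> /finite_seqP[cs ->]; elim: cs => [|C cs IH] hC; first by exists [::].
have [F hF] : exists F : seq (seq X), forall D x, D \in cs ->
    exists2 A, A \in F & metric_projector D x = x - Q A x.
  by apply: IH => D Dcs; apply: hC; rewrite /= inE Dcs orbT.
have [C0 pC] : C !=set0 /\ polyhedral_cone dot C by apply: hC; rewrite /= mem_head.
have [s CE] := polyhedral_cone_dual C0 pC.
exists ([seq mask (val t) s | t <- enum {: (size s).-tuple bool}] ++ F) => D x /=.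
rewrite inE => /predU1P[->|/(hF _ x)[A AF DA]]; last first.
  by exists A; rewrite // mem_cat AF orbT.
have [m sm Dm] := metric_projector_dual_cone s x.
have sm' : size m == size s by rewrite sm.
exists (mask m s); last by rewrite CE.
by rewrite mem_cat; apply/orP; left; apply/mapP; exists (Tuple sm'); rewrite ?mem_enum.
Qed.

End PolyhedralCones.

Theorem theorem3p2 (R : realType) (X : completeNormedModType R)
  (dot : {dot X for idfun}) (hdot : induces_norm dot)
  (CC : set (set X)) (CC_neq0 : CC !=set0) (CC_fin : finite_set CC)
  (CC_cones : forall C, CC C -> C !=set0 /\ polyhedral_cone dot C)
  (lambda : R) (lambda_gt0 : 0 < lambda) (lambda_le1 : lambda <= 1)
  (x0 : X) (x : nat -> X) (Rn : nat -> X -> X)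
  (x_init : x 0%N = x0)
  (Rn_in : forall n, relaxed_projectors CC `[lambda, 2 - lambda] (Rn n))
  (x_step : forall n, x n.+1 = Rn n (x n)) :
  forall gamma : R, 0 < gamma ->
    (\sum_(0 <= n <oo) (`|x n.+1 - x n| `^ gamma)%:E < +oo)%E.
Proof.
move=> gamma gamma_gt0.
have [F hF] := metric_projector_finite hdot CC_fin CC_cones.
pose A (j : 'I_(size F)) := nth [::] F j.
have /choice[s hs] n : exists s : 'I_(size F) * R,
    lambda <= s.2 <= 2 - lambda /\ x n.+1 = step dot A s (x n).
  rewrite x_step; have [C CC_C [mu mu_in <-]] := Rn_in n.
  have [B BF ->] := hF C (x n) CC_C.
  have iB : (index B F < size F)%N by rewrite index_mem.
  exists (Ordinal iB, mu); split; first by move: mu_in; rewrite /= in_itv.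
  rewrite /step /A /= nth_index// scalerBr scalerBl scale1r addrA subrK.
  by [].
have runE n : run dot A (mkseq s n) (x 0%N) = x n.
  by elim: n => // n IH; rewrite mkseqS -cats1 run_cat IH /= (hs n).2.
have sumE n : \sum_(0 <= k < n) `|x k.+1 - x k| `^ gamma =
    path_length dot A gamma (mkseq s n) (x 0%N).
  elim: n => [|n IH]; first by rewrite big_geq.
  by rewrite mkseqS -cats1 path_length_cat big_nat_recr//= IH runE /= addr0 (hs n).2.
pose I := [set: 'I_(size F)]%SET.
(* [T] is independent of the length of the word, so one constant bounds all partial sums. *)
have [T _ hT] := path_length_bound hdot A lambda_gt0 gamma_gt0 #|I|.
pose K := T * dist_inter dot A I (x 0%N) `^ gamma.
apply: (@le_lt_trans _ _ K%:E); last exact: ltry.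
apply: lime_le.
  by apply: is_cvg_nneseries => n _ _; rewrite lee_fin powR_ge0.
apply: nearW => n; rewrite sumEFin lee_fin sumE; apply: hT => //.
  by rewrite /admissible; apply/allP => _ /mapP[k _ ->]; exact: (hs k).1.
exact: finset.subsetT.
Qed.
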